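(* Let $R$ be a commutative ring with unit; all weights are non-vanishing with values in $R$. (I) The identity morphism $\mathrm{id}$ from a weighted digraph $(G,w)$ to itself induces the identity map $\mathrm{id}_*$ on $H_*(G,w;R)$. (II) Given two morphisms of weighted digraphs $f:(G,w)\longrightarrow(G',w')$ and $g:(G',w')\longrightarrow(G'',w'')$, the homomorphism $(g\circ f)_*$ induced on weighted path homology by the composition $g\circ f$ is the composition $g_*\circ f_*$ of the induced homomorphisms.
   Context: A digraph $G=(V,E)$ consists of a finite nonempty set $V$ and a set $E$ of ordered pairs $(u,v)\in V\times V$ with $u\ne v$; write $u\to v$ for $(u,v)\in E$. A weight on $G$ is a function $w:V\to R$; it is non-vanishing if $w(i)\neq 0$ for all $i\in V$. $(G,w)$ is a weighted digraph. For $p\ge 0$, $\Lambda_p(V)$ is the free $R$-module on all sequences (elementary $p$-paths) $e_{i_0\cdots i_p}$, $i_k\in V$; $\Lambda_{-1}(V)=R$ (generated by the empty path) and $\Lambda_{-2}(V)=0$. An elementary path is regular if $i_k\ne i_{k+1}$ for all $k$, otherwise non-regular. $\mathcal R_p(V)$ and $\mathcal I_p(V)$ are the submodules of $\Lambda_p(V)$ generated by the regular, resp. non-regular, elementary $p$-paths, and $\mathcal R_p(V)\cong\Lambda_p(V)/\mathcal I_p(V)$. The weighted boundary operator is $\partial^w e_{i_0\cdots i_p}=\sum_{q=0}^p(-1)^q w(i_q)\,e_{i_0\cdots\widehat{i_q}\cdots i_p}$, extended linearly; it induces $\partial^w:\mathcal R_p(V)\to\mathcal R_{p-1}(V)$ through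 this isomorphism (i.e. non-regular terms are set to $0$), with $\partial^w\partial^w=0$. An elementary path $e_{i_0\cdots i_p}$ is allowed on $G$ if $i_{k-1}\to i_k$ for all $k=1,\dots,p$. $\mathcal A_p(G)\subseteq\mathcal R_p(V)$ is the submodule generated by allowed elementary $p$-paths ($\mathcal A_{-1}(G)=R$). Put $\Omega^w_p(G)=\{v\in\mathcal A_p(G):\partial^w v\in\mathcal A_{p-1}(G)\}$; these form a chain complex under $\partial^w$. The weighted path homology $H_p(G,w;R)$, $p\ge0$, is the $p$-th homology of the truncated complex $\cdots\to\Omega^w_1(G)\to\Omega^w_0(G)\to0$ (the map $\Omega^w_0(G)\to R$ is replaced by $\Omega^w_0(G)\to 0$). A morphism of weighted digraphs $f:(G,w)\to(G',w')$, $G'=(V',E')$, is a map $f:V\to V'$ such that $i\to j$ in $G$ implies $f(i)\to f(j)$ in $G'$ or $f(i)=f(j)$, and $w(i)=w'(f(i))$ for all $i\in V$. The induced map $f_\#:\mathcal R_p(V)\to\mathcal R_p(V')$ sends $e_{i_0\cdots i_p}$ to $e_{f(i_0)\cdots f(i_p)}$ if the latter is regular and to $0$ otherwise; it restricts to a chain map $\{\Omega^w_*(G),\partial^w\}\to\{\Omega^{w'}_*(G'),\partial^{w'}\}$, and $f_*:H_p(G,w;R)\to H_p(G',w';R)$ denotes the induced map on homology. *)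

(* Defs.v *)
From HB Require Import structures.
From mathcomp Require Import all_boot all_algebra.
From mathcomp Require Import zify ring.
From mathcomp Require Import boolp.

Set Implicit Arguments.
Unset Strict Implicit.
Unset Printing Implicit Defensive.

Import GRing.Theory.
Local Open Scope ring_scope.
Local Open Scope quotient_scope.

(* Chain complexes are concentrated in degrees p >= 0: the differential leaving
   degree 0 is the map to 0, so every element of degree 0 is a cycle. *)
Record chain_complex (R : pzRingType) := ChainComplex {
  chain_mod :> nat -> lmodType R;
  diff : forall p, {linear chain_mod p.+1 -> chain_mod p};
  diff_diff : forall p (x : chain_mod p.+2), diff p (diff p.+1 x) = 0 }.

Record chain_map (R : pzRingType) (C D : chain_complex R) := ChainMap {
  chain_fun :> forall p, {linear C p -> D p};
  chain_fun_diff : forall p (x : C p.+1),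
    chain_fun p (diff C p x) = diff D p (chain_fun p.+1 x) }.

Section Homology.
Variables (R : pzRingType) (C : chain_complex R).

Definition cycle_pred p : {pred C p} :=
  match p return {pred C p} with
  | 0 => predT
  | p'.+1 => fun x => diff C p' x == 0
  end.

Lemma cycle_pred_closed p : GRing.subsemimod_closed (@cycle_pred p).
Proof.
case: p => [|p]; first by split.
split; first split.
- by rewrite unfold_in /= raddf0.
- move=> x y; rewrite !unfold_in /= => /eqP x0 /eqP y0.
  by rewrite raddfD /= x0 y0 addr0.
- by move=> a x; rewrite !unfold_in /= => /eqP x0; rewrite linearZ /= x0 scaler0.
Qed.

HB.instance Definition _ p :=
  GRing.isSubmodClosed.Build R (C p) (@cycle_pred p) (@cycle_pred_closed p).

Record cycles p := Cycle { cycle_val : C p; _ : cycle_val \in @cycle_pred p }.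

HB.instance Definition _ p := [isSub for @cycle_val p].
HB.instance Definition _ p := [Choice of cycles p by <:].
HB.instance Definition _ p := [SubChoice_isSubLmodule of cycles p by <:].

Definition boundaries p : {pred cycles p} :=
  fun z => `[< exists x : C p.+1, diff C p x = val z >].

Lemma boundaries_closed p : GRing.subsemimod_closed (@boundaries p).
Proof.
split; first split.
- by apply/asboolP; exists 0; rewrite !raddf0.
- move=> z1 z2 /asboolP[x1 e1] /asboolP[x2 e2].
  by apply/asboolP; exists (x1 + x2); rewrite !raddfD /= e1 e2.
- move=> a z /asboolP[x e].
  by apply/asboolP; exists (a *: x); rewrite !linearZ /= e.
Qed.

HB.instance Definition _ p := GRing.isSubmodClosed.Build R (cycles p)
  (@boundaries p) (@boundaries_closed p).

Definition homology p := Quotient.quot (@boundaries p).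

HB.instance Definition _ p := GRing.Zmodule.on (homology p).

Definition homology_class p (z : cycles p) : homology p := \pi z.

Lemma homology_classP p (z1 z2 : cycles p) :
  reflect (exists x, diff C p x = val z1 - val z2)
          (homology_class z1 == homology_class z2).
Proof.
rewrite /homology_class -Quotient.idealrBE unfold_in.
by apply: (iffP (asboolP _)) => -[x e]; exists x; rewrite e raddfB.
Qed.

Lemma homology_repr p (h : homology p) : homology_class (repr h) = h.
Proof. exact: reprK. Qed.

Lemma homology_class_is_zmod_morphism p : zmod_morphism (@homology_class p).
Proof. exact: raddfB. Qed.

HB.instance Definition _ p := GRing.isZmodMorphism.Build (cycles p) (homology p)
  (@homology_class p) (@homology_class_is_zmod_morphism p).

Definition homology_scale p (a : R) (h : homology p) : homology p :=
  homology_class (a *: repr h).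

Lemma homology_scaleE p a (z : cycles p) :
  homology_scale a (homology_class z) = homology_class (a *: z).
Proof.
apply/eqP/homology_classP.
have /eqP/homology_classP[x e] := homology_repr (homology_class z).
by exists (a *: x); rewrite linearZ /= e scalerBr.
Qed.

Lemma homology_scaleA p a b (h : homology p) :
  homology_scale a (homology_scale b h) = homology_scale (a * b) h.
Proof. by rewrite -(homology_repr h) !homology_scaleE scalerA. Qed.

Lemma homology_scale1 p : left_id 1 (@homology_scale p).
Proof. by move=> h; rewrite -(homology_repr h) homology_scaleE scale1r. Qed.

Lemma homology_scaleDr p : right_distributive (@homology_scale p) +%R.
Proof.
move=> a h k; rewrite -(homology_repr h) -(homology_repr k).
by rewrite -raddfD !homology_scaleE -raddfD scalerDr.
Qed.

Lemma homology_scaleDl p h : {morph (@homology_scale p)^~ h : a b / a + b}.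
Proof.
move=> a b; rewrite -(homology_repr h) !homology_scaleE scalerDl.
by rewrite raddfD.
Qed.

HB.instance Definition _ p := GRing.Zmodule_isLmodule.Build R (homology p)
  (@homology_scaleA p) (@homology_scale1 p) (@homology_scaleDr p)
  (@homology_scaleDl p).

Lemma homology_class_is_scalable p : scalable (@homology_class p).
Proof. by move=> a z; rewrite -homology_scaleE. Qed.

HB.instance Definition _ p := GRing.isScalable.Build R (cycles p) (homology p)
  *:%R (@homology_class p) (@homology_class_is_scalable p).

End Homology.

Section HomologyMap.
Variables (R : pzRingType) (C D : chain_complex R) (F : chain_map C D).

Lemma cycle_map_subproof p (z : cycles C p) :
  F p (val z) \in @cycle_pred R D p.
Proof.
case: p z => [//|p] [z /= zP]; rewrite unfold_in /= -chain_fun_diff.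
by move: zP; rewrite unfold_in /= => /eqP->; rewrite raddf0.
Qed.

Definition cycle_map p (z : cycles C p) : cycles D p :=
  Cycle (cycle_map_subproof z).

Lemma cycle_map_is_linear p : linear (@cycle_map p).
Proof.
move=> a x y; apply: val_inj => /=.
by rewrite !linearP.
Qed.

HB.instance Definition _ p := GRing.isLinear.Build R (cycles C p) (cycles D p)
  *:%R (@cycle_map p) (@cycle_map_is_linear p).

Definition homology_map p (h : homology C p) : homology D p :=
  homology_class (cycle_map (repr h)).

Lemma homology_mapE p (z : cycles C p) :
  homology_map (homology_class z) = homology_class (cycle_map z).
Proof.
apply/eqP/homology_classP.
have /eqP/homology_classP[x e] := homology_repr (homology_class z).
by exists (F p.+1 x); rewrite -chain_fun_diff e raddfB.
Qed.

Lemma homology_map_is_linear p : linear (@homology_map p).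
Proof.
move=> a h k; rewrite -(homology_repr h) -(homology_repr k).
by rewrite -linearP !homology_mapE linearP /= linearP.
Qed.

HB.instance Definition _ p := GRing.isLinear.Build R (homology C p)
  (homology D p) *:%R (@homology_map p) (@homology_map_is_linear p).

End HomologyMap.

Record digraph := Digraph {
  vertex :> finType;
  vertex_nonempty : (0 < #|vertex|)%N;
  arc : rel vertex;
  arc_irrefl : irreflexive arc }.

Record wdigraph (R : comPzRingType) := WDigraph {
  wgraph :> digraph;
  weight : wgraph -> R }.

Definition nonvanishing (R : comPzRingType) (G : wdigraph R) :=
  forall i : G, weight i != 0.

Record wmorphism (R : comPzRingType) (G G' : wdigraph R) := WMorphism {
  wmor_fun :> G -> G';
  wmor_arc : forall i j,
    arc i j -> arc (wmor_fun i) (wmor_fun j) \/ wmor_fun i = wmor_fun j;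
  wmor_weight : forall i, weight i = weight (wmor_fun i) }.

Definition wmor_id (R : comPzRingType) (G : wdigraph R) : wmorphism G G :=
  @WMorphism R G G id (fun _ _ e => or_introl e) (fun _ => erefl).

Lemma wmor_comp_arc (R : comPzRingType) (G G' G'' : wdigraph R)
    (g : wmorphism G' G'') (f : wmorphism G G') i j :
  arc i j -> arc ((g \o f) i) ((g \o f) j) \/ (g \o f) i = (g \o f) j.
Proof.
by move=> /(wmor_arc f)[/(wmor_arc g)//|e]; right; rewrite /= e.
Qed.

Lemma wmor_comp_weight (R : comPzRingType) (G G' G'' : wdigraph R)
    (g : wmorphism G' G'') (f : wmorphism G G') i :
  weight i = weight ((g \o f) i).
Proof. by rewrite /= -!wmor_weight. Qed.

Definition wmor_comp (R : comPzRingType) (G G' G'' : wdigraph R)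
    (g : wmorphism G' G'') (f : wmorphism G G') : wmorphism G G'' :=
  @WMorphism R G G'' (g \o f) (@wmor_comp_arc R G G' G'' g f)
    (@wmor_comp_weight R G G' G'' g f).

(* [chains R V n] is Lambda_(n-1)(V): paths are indexed by their number n of
   vertices, so that [chains R V 0] is the copy of R spanned by the empty path
   and an elementary p-path is a p.+1-tuple. *)
Definition chains (R : comPzRingType) (V : finType) (n : nat) :=
  {ffun n.-tuple V -> R^o}.
HB.instance Definition _ R V n := GRing.Lmodule.on (@chains R V n).

Definition epath (R : comPzRingType) (V : finType) n (t : n.-tuple V) :
  chains R V n := [ffun s => (s == t)%:R].

Definition lin_ext (R : comPzRingType) (V : finType) n (M : lmodType R)
    (F : n.-tuple V -> M) (v : chains R V n) : M := \sum_t v t *: F t.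

(* Deletion of the vertex of index q: [lift q] skips q. *)
Definition face (V : finType) n (q : 'I_n.+1) (t : n.+1.-tuple V) : n.-tuple V :=
  [tuple tnth t (lift q i) | i < n].

Definition regular (V : finType) n (t : n.-tuple V) : bool :=
  sorted (fun i j => i != j) t.

Definition allowed (G : digraph) n (t : n.-tuple G) : bool :=
  sorted (@arc G) t.

(* R_p(V) and A_p(G) are realized inside Lambda_p(V) as the chains supported on
   regular, resp. allowed, elementary paths; [reg_proj] is the composite of
   Lambda_p(V) -> Lambda_p(V)/I_p(V) with the isomorphism onto R_p(V). *)
Definition supported (R : comPzRingType) (V : finType) n (P : pred (n.-tuple V)) :
    {pred chains R V n} := fun v => [forall t, (v t != 0) ==> P t].

Definition reg_proj (R : comPzRingType) (V : finType) n (v : chains R V n) :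
  chains R V n := [ffun t => if regular t then v t else 0].

Section LinExt.
Variables (R : comPzRingType) (V : finType).

Lemma lin_ext_is_linear n (M : lmodType R) (F : n.-tuple V -> M) :
  linear (@lin_ext R V n M F).
Proof.
move=> a u v; rewrite /lin_ext scaler_sumr -big_split /=.
by apply: eq_bigr => t _; rewrite !ffunE scalerDl scalerA.
Qed.

HB.instance Definition _ n (M : lmodType R) (F : n.-tuple V -> M) :=
  GRing.isLinear.Build R (chains R V n) M *:%R
  (@lin_ext R V n M F) (@lin_ext_is_linear n M F).

Lemma lin_ext_epath n (M : lmodType R) (F : n.-tuple V -> M) t :
  lin_ext F (epath R t) = F t.
Proof.
rewrite /lin_ext (bigD1 t) //= big1 ?addr0 ?ffunE ?eqxx ?scale1r //.
by move=> s /negPf st; rewrite ffunE st scale0r.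
Qed.

Lemma chains_epath n (v : chains R V n) : v = \sum_t v t *: epath R t.
Proof.
apply/ffunP => s; rewrite sum_ffunE (bigD1 s) //= big1.
  by rewrite !ffunE eqxx addr0 /GRing.scale /= mulr1.
by move=> t /negPf st; rewrite !ffunE eq_sym st scaler0.
Qed.

Lemma chains_ext n (M : lmodType R) (f g : {linear chains R V n -> M}) :
  (forall t, f (epath R t) = g (epath R t)) -> f =1 g.
Proof.
move=> fg v; rewrite (chains_epath v) !linear_sum.
by apply: eq_bigr => t _; rewrite !linearZ /= fg.
Qed.

Lemma reg_proj_is_linear n : linear (@reg_proj R V n).
Proof.
move=> a u v; apply/ffunP => t; rewrite !ffunE.
by case: ifP => _ //; rewrite scaler0 addr0.
Qed.

HB.instance Definition _ n := GRing.isLinear.Build R (chains R V n)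
  (chains R V n) *:%R (@reg_proj R V n) (@reg_proj_is_linear n).

Lemma reg_proj_epath n (t : n.-tuple V) :
  reg_proj (epath R t) = if regular t then epath R t else 0.
Proof.
apply/ffunP => s; rewrite !ffunE; have [->|st] := eqVneq s t.
  by case: ifP; rewrite !ffunE ?eqxx.
by case: ifP => _; case: ifP => _; rewrite ?ffunE ?(negPf st).
Qed.

Lemma supportedP n (P : pred (n.-tuple V)) (v : chains R V n) :
  reflect (forall t, ~~ P t -> v t = 0) (v \in supported P).
Proof.
rewrite unfold_in; apply: (iffP forallP) => vP t.
  by move=> nPt; apply/eqP; have := vP t; rewrite implybE (negPf nPt) orbF negbK.
by apply/implyP => vt; apply: contraR vt => /vP ->.
Qed.

Lemma supported_closed n (P : pred (n.-tuple V)) :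
  GRing.subsemimod_closed (@supported R V n P).
Proof.
split; first split.
- by apply/supportedP => t _; rewrite ffunE.
- move=> u v /supportedP uP /supportedP vP; apply/supportedP => t Pt.
  by rewrite ffunE uP ?vP ?addr0.
- move=> a v /supportedP vP; apply/supportedP => t Pt.
  by rewrite ffunE vP ?scaler0.
Qed.

HB.instance Definition _ n P := GRing.isSubmodClosed.Build R (chains R V n)
  (@supported R V n P) (@supported_closed n P).

Lemma supported_epath n (P : pred (n.-tuple V)) t :
  P t -> epath R t \in @supported R V n P.
Proof.
move=> Pt; apply/supportedP => s nPs; rewrite ffunE.
by case: eqP => // e; rewrite e Pt in nPs.
Qed.

End LinExt.

Lemma supported_lin (R : comPzRingType) (V : finType) n m (P : pred (n.-tuple V)) (W : finType)
    (Q : pred (m.-tuple W)) (f : {linear chains R V n -> chains R W m}) v :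
  (forall t, P t -> f (epath R t) \in @supported R W m Q) ->
  v \in @supported R V n P -> f v \in @supported R W m Q.
Proof.
move=> fPQ /supportedP vP; rewrite (chains_epath v) linear_sum rpred_sum // => t _.
rewrite linearZ /=; have [/fPQ/rpredZ->//|/vP ->] := boolP (P t).
by rewrite scale0r rpred0.
Qed.

Lemma bump_bump a j k : (a <= j)%N -> bump a (bump j k) = bump j.+1 (bump a k).
Proof. by rewrite /bump; lia. Qed.

Section Boundary.
Variables (R : comPzRingType) (V : finType) (w : V -> R).

(* The boundary on Lambda_p(V); a p-path is indexed by n.+1 = p.+1. *)
Definition boundary0 n : chains R V n.+1 -> chains R V n :=
  lin_ext (fun t => \sum_(q < n.+1) ((-1) ^+ q * w (tnth t q)) *: epath R (face q t)).

HB.instance Definition _ n := GRing.Linear.on (@boundary0 n).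

(* The boundary induced on R_p(V): non-regular terms are set to 0. *)
Definition boundary n : chains R V n.+1 -> chains R V n :=
  @reg_proj R V n \o @boundary0 n.

HB.instance Definition _ n := GRing.Linear.on (@boundary n).

Lemma boundary0_epath n (t : n.+1.-tuple V) : boundary0 (epath R t) =
  \sum_(q < n.+1) ((-1) ^+ q * w (tnth t q)) *: epath R (face q t).
Proof. exact: lin_ext_epath. Qed.

Lemma tnth_face n (q : 'I_n.+1) (t : n.+1.-tuple V) i :
  tnth (face q t) i = tnth t (lift q i).
Proof. by rewrite tnth_mktuple. Qed.

Lemma boundary00 n (v : chains R V n.+2) : boundary0 (boundary0 v) = 0.
Proof.
move: v; apply: (@chains_ext R V n.+2 (chains R V n)
  (@boundary0 n \o @boundary0 n.+1 : {linear _ -> _}) (\0 : {linear _ -> _})) => t.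
rewrite /= boundary0_epath linear_sum /=.
pose F (a b : 'I_n.+2) : chains R V n := if unlift a b is Some j then
  ((-1) ^+ a * w (tnth t a)) *: (((-1) ^+ j * w (tnth t b)) *: epath R (face j (face a t)))
  else 0.
transitivity (\sum_a \sum_b F a b).
  apply: eq_bigr => a _; rewrite linearZ /= boundary0_epath scaler_sumr.
  rewrite (bigD1_ord a) //= {1}/F unlift_none add0r.
  by apply: eq_bigr => j _; rewrite /F liftK tnth_face.
have FC (a b : 'I_n.+2) : (a < b)%N -> F a b + F b a = 0.
  move=> ab; rewrite /F.
  have nab : a != b by rewrite neq_ltn ab.
  have [j bj ->] := unlift_some nab.
  have nba : b != a by rewrite eq_sym.
  have [i ai ->] := unlift_some nba.
  have vj : b = j.+1 :> nat.
    move/(congr1 val): bj => /=; rewrite /bump; case: leqP => // ja e.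
    by move: ab; rewrite e ltnNge (ltnW ja).
  have vi : a = i :> nat.
    move/(congr1 val): ai => /=; rewrite /bump; case: leqP => // ja e.
    by move: ab; rewrite e ltnNge (leq_trans ja).
  have -> : face j (face a t) = face i (face b t).
    apply: eq_from_tnth => k; rewrite !tnth_face; congr (tnth t _).
    by apply: val_inj; rewrite /= vj -vi bump_bump // -ltnS -vj.
  rewrite !scalerA -scalerDl vj -vi exprS.
  rewrite [X in X *: _](_ : _ = 0) ?scale0r //.
  by rewrite mulN1r; ring.
have -> : \sum_a \sum_b F a b =
    \sum_(a < n.+2) \sum_(b < n.+2 | (a < b)%N) F a b +
    \sum_(a < n.+2) \sum_(b < n.+2 | (b < a)%N) F a b.
  rewrite -big_split; apply: eq_bigr => a _ /=.
  rewrite (bigID (fun b : 'I_n.+2 => (a < b)%N)) /=; congr (_ + _).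
  rewrite (bigD1 a) /= ?ltnn // {1}/F unlift_none add0r.
  by apply: eq_bigl => b; rewrite -leqNgt ltn_neqAle andbC.
rewrite [X in _ + X](exchange_big_dep xpredT) //= -big_split /=.
by apply: big1 => a _; rewrite -big_split; apply: big1 => b /FC.
Qed.

Lemma regularP n (t : n.-tuple V) :
  reflect (forall i j : 'I_n, j = i.+1 :> nat -> tnth t i != tnth t j) (regular t).
Proof.
case: n t => [|n] t; first by rewrite tuple0; apply: ReflectT => -[].
apply: (iffP (sortedP (thead t))) => [h i j ij|h i].
  by rewrite !(tnth_nth (thead t)) ij h // size_tuple -ij.
rewrite size_tuple => lti.
by have := h (Ordinal (ltnW lti)) (Ordinal lti) erefl; rewrite !(tnth_nth (thead t)).
Qed.

Lemma boundary_nonregular n (t : n.+1.-tuple V) :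
  ~~ regular t -> boundary (epath R t) = 0.
Proof.
case: n t => [|n] t ; first by case/tupleP: t => x t; rewrite tuple0.
move=> /regularP nreg.
have [i [j [ij tij]]] : exists i j : 'I_n.+2, j = i.+1 :> nat /\ tnth t i = tnth t j.
  apply: contrapT => h; apply: nreg => i j ij; apply/eqP => tij.
  by apply: h; exists i, j.
rewrite /boundary /= boundary0_epath linear_sum /=.
have nij : j != i by apply/eqP => e; move: ij; rewrite e => /n_Sn.
rewrite (bigD1 i) //= (bigD1 j) //= big1 ?addr0.
  have -> : face j t = face i t.
    apply: eq_from_tnth => k; rewrite !tnth_face.
    have [kj|kj] := eqVneq (k : nat) i.
      have -> : lift j k = i by apply: val_inj; rewrite /= /bump; lia.
      have -> : lift i k = j by apply: val_inj; rewrite /= /bump; lia.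
      by [].
    by congr (tnth t _); apply: val_inj; rewrite /= /bump; lia.
  rewrite !linearZ /= -scalerDl tij ij exprS mulN1r mulNr addrN.
  by rewrite scale0r.
move=> q /andP[qi qj]; rewrite linearZ /= reg_proj_epath.
rewrite ifN ?scaler0 //; apply/regularP => h.
have [i' qi' _] := unlift_some qi; have [j' qj' _] := unlift_some qj.
have := h i' j'; rewrite !tnth_face -qi' -qj' tij eqxx => /(_ _)/negP; apply => //.
move: ij; rewrite qi' qj' /= /bump.
move/eqP: qi; move/eqP: qj => qj qi.
have {}qj : val q <> val j by move/val_inj.
have {}qi : val q <> val i by move/val_inj.
move: qi qj; rewrite qi' qj' /= /bump; lia.
Qed.

Lemma boundary_reg_proj n (v : chains R V n.+1) :
  boundary (reg_proj v) = boundary v.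
Proof.
move: v; apply: (@chains_ext R V n.+1 (chains R V n)
  (@boundary n \o @reg_proj R V n.+1 : {linear _ -> _})
  (@boundary n : {linear _ -> _})) => t.
rewrite /= reg_proj_epath; case: ifPn => // /boundary_nonregular ->.
by rewrite linear0.
Qed.

Lemma boundary_boundary n (v : chains R V n.+2) : boundary (boundary v) = 0.
Proof.
by rewrite [X in boundary X]/boundary /= boundary_reg_proj /boundary /= boundary00 raddf0.
Qed.

End Boundary.

(* The weighted path complex, truncated in degree 0. The condition defining
   Omega_0 involves the boundary into A_(-1) = R and always holds there. *)
Section PathComplex.
Variables (R : comPzRingType) (G : wdigraph R).

Definition allowed_chains n : {pred chains R G n} := supported (@allowed G n).

HB.instance Definition _ n := GRing.isSubmodClosed.Build R (chains R G n)
  (@allowed_chains n) (@supported_closed R G n (@allowed G n)).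

Lemma allowed_regular n (t : n.-tuple G) : allowed t -> regular t.
Proof.
apply: sub_sorted => i j; apply: contraTneq => ->.
by rewrite arc_irrefl.
Qed.

Definition omega_pred p : {pred chains R G p.+1} := fun v =>
  (v \in @allowed_chains p.+1) && (boundary (@weight R G) v \in @allowed_chains p).

Lemma omega_pred_closed p : GRing.subsemimod_closed (@omega_pred p).
Proof.
split; first split.
- by apply/andP; split; rewrite ?linear0 rpred0.
- move=> u v /andP[u1 u2] /andP[v1 v2].
  by apply/andP; split; rewrite ?linearD; apply: rpredD.
- move=> a v /andP[v1 v2].
  by apply/andP; split; rewrite ?linearZ; apply: rpredZ.
Qed.

HB.instance Definition _ p := GRing.isSubmodClosed.Build R (chains R G p.+1)
  (@omega_pred p) (@omega_pred_closed p).

Record omega p := Omega {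
  omega_val : chains R G p.+1;
  _ : omega_val \in @omega_pred p }.

HB.instance Definition _ p := [isSub for @omega_val p].
HB.instance Definition _ p := [Choice of omega p by <:].
HB.instance Definition _ p := [SubChoice_isSubLmodule of omega p by <:].

Lemma omega_diff_subproof p (v : omega p.+1) :
  boundary (@weight R G) (val v) \in @omega_pred p.
Proof.
case: v => v /= /andP[_ bv]; apply/andP; split=> //.
by rewrite boundary_boundary rpred0.
Qed.

Definition omega_diff p (v : omega p.+1) : omega p :=
  Omega (omega_diff_subproof v).

Lemma omega_diff_is_linear p : linear (@omega_diff p).
Proof. by move=> a u v; apply: val_inj; rewrite /= !linearP. Qed.

HB.instance Definition _ p := GRing.isLinear.Build R (omega p.+1) (omega p) *:%R
  (@omega_diff p) (@omega_diff_is_linear p).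

Lemma omega_diff_diff p (v : omega p.+2) : omega_diff (omega_diff v) = 0.
Proof. by apply: val_inj; rewrite /= boundary_boundary. Qed.

Definition path_complex : chain_complex R :=
  @ChainComplex R omega (fun p => @omega_diff p) omega_diff_diff.

Definition path_homology p : lmodType R := homology path_complex p.

End PathComplex.

(* Restricted to R_p(V), this is f_#; non-regular paths of Lambda_p(V) are sent
   to 0, since their images are non-regular. *)
Definition map_chain (R : comPzRingType) (V V' : finType) (f : V -> V') n :
    chains R V n -> chains R V' n :=
  lin_ext (fun t => if regular (map_tuple f t) then epath R (map_tuple f t) else 0).

HB.instance Definition _ R V V' f n := GRing.Linear.on (@map_chain R V V' f n).

Section PathMap.
Variables (R : comPzRingType) (G G' : wdigraph R) (f : wmorphism G G').

Lemma map_chain_epath n (t : n.-tuple G) :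
  map_chain f (epath R t) = reg_proj (epath R (map_tuple f t)).
Proof. by rewrite /map_chain lin_ext_epath reg_proj_epath. Qed.

Lemma map_face n (q : 'I_n.+1) (t : n.+1.-tuple G) :
  map_tuple f (face q t) = face q (map_tuple f t).
Proof. by apply: eq_from_tnth => k; rewrite tnth_map !tnth_face tnth_map. Qed.

Lemma map_chain_reg_proj n (v : chains R G n) :
  map_chain f (reg_proj v) = map_chain f v.
Proof.
move: v; apply: (@chains_ext R G n (chains R G' n)
  (@map_chain R G G' f n \o @reg_proj R G n : {linear _ -> _})
  (@map_chain R G G' f n : {linear _ -> _})) => t.
rewrite /= reg_proj_epath; case: ifPn => // nreg.
rewrite linear0 map_chain_epath reg_proj_epath ifN //; apply: contra nreg.
rewrite /regular sorted_map; apply: sub_sorted => i j /=.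
by apply: contra => /eqP ->.
Qed.

Lemma map_chain_boundary n (v : chains R G n.+1) :
  map_chain f (boundary (@weight R G) v) = boundary (@weight R G') (map_chain f v).
Proof.
move: v; apply: (@chains_ext R G n.+1 (chains R G' n)
  (@map_chain R G G' f n \o @boundary R G (@weight R G) n : {linear _ -> _})
  (@boundary R G' (@weight R G') n \o @map_chain R G G' f n.+1 :
     {linear _ -> _})) => t.
rewrite /= map_chain_reg_proj map_chain_epath boundary_reg_proj /boundary /=.
rewrite !boundary0_epath !linear_sum; apply: eq_bigr => q _ /=.
by rewrite !linearZ /= map_chain_epath map_face tnth_map -wmor_weight.
Qed.

Lemma map_chain_allowed n (v : chains R G n) :
  v \in @allowed_chains R G n -> map_chain f v \in @allowed_chains R G' n.
Proof.
apply: (@supported_lin R G n n (@allowed G n) G' (@allowed G' n)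
  (@map_chain R G G' f n : {linear _ -> _})) => t tall /=.
rewrite map_chain_epath reg_proj_epath; case: ifPn => [reg|]; last by rewrite rpred0.
apply: supported_epath; move: tall reg => {v}.
case: n t => [|n] t; first by rewrite /allowed !tuple0.
rewrite /allowed /regular !sorted_map.
move=> /(sortedP (thead t)) tall /(sortedP (thead t)) reg.
apply/(sortedP (thead t)) => i ilt /=.
by case: (wmor_arc f (tall i ilt)) => // e; have := reg i ilt; rewrite /= e eqxx.
Qed.

Lemma omega_map_subproof p (v : omega G p) :
  map_chain f (val v) \in @omega_pred R G' p.
Proof.
case: v => v /= /andP[v1 v2]; apply/andP; split; first exact: map_chain_allowed.
by rewrite -map_chain_boundary map_chain_allowed.
Qed.

Definition omega_map p (v : omega G p) : omega G' p :=
  Omega (omega_map_subproof v).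

Lemma omega_map_is_linear p : linear (@omega_map p).
Proof. by move=> a u v; apply: val_inj; rewrite /= !linearP. Qed.

HB.instance Definition _ p := GRing.isLinear.Build R (omega G p) (omega G' p)
  *:%R (@omega_map p) (@omega_map_is_linear p).

Lemma omega_map_diff p (v : omega G p.+1) :
  omega_map (omega_diff v) = omega_diff (omega_map v).
Proof. by apply: val_inj; rewrite /= map_chain_boundary. Qed.

Definition path_chain_map : chain_map (path_complex G) (path_complex G') :=
  @ChainMap R (path_complex G) (path_complex G') (fun p => @omega_map p)
    omega_map_diff.

Definition path_homology_map p :
    {linear path_homology G p -> path_homology G' p} :=
  @homology_map R _ _ path_chain_map p.

End PathMap.

(* Main.v *)
Require Import Defs.
From mathcomp Require Import all_boot all_algebra.

Set Implicit Arguments.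
Unset Strict Implicit.
Unset Printing Implicit Defensive.

(** Homology is functorial, so both identities only need checking on chains, where linearity reduces
    them to elementary paths ([map_chain_id], [map_chain_comp]). The one subtlety is the discarding
    of non-regular paths: it is invisible on Omega, whose chains are supported on allowed, hence
    regular, paths, and it is compatible with composition because a vertex map keeps equal
    neighbours equal. *)

Lemma homology_map_id (R : pzRingType) (C : chain_complex R)
    (F : chain_map C C) p :
  F p =1 id -> homology_map F (p := p) =1 id.
Proof.
move=> Fid h; rewrite -(homology_repr h) homology_mapE.
by congr homology_class; apply: val_inj; apply: Fid.
Qed.

(** Taking [L] as a separate chain map that agrees pointwise with the composite avoids forming a
    composite chain map and comparing records. *)
Lemma homology_map_comp (R : pzRingType) (C D E : chain_complex R)
    (F : chain_map C D) (K : chain_map D E) (L : chain_map C E) p :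
  L p =1 K p \o F p ->
  homology_map L (p := p) =1 homology_map K (p := p) \o homology_map F (p := p).
Proof.
move=> LKF h; rewrite -(homology_repr h) /= !homology_mapE.
by congr homology_class; apply: val_inj; apply: LKF.
Qed.

Lemma reg_proj_allowed (R : comPzRingType) (G : wdigraph R) n (v : chains R G n) :
  v \in @allowed_chains R G n -> reg_proj v = v.
Proof.
move=> /supportedP vA; apply/ffunP => t; rewrite ffunE.
by case: ifPn => // nreg; rewrite vA //; apply: contra nreg; apply: allowed_regular.
Qed.

(** Since [map_chain] is defined on all of Lambda, the identity vertex map still kills non-regular
    paths. *)
Lemma map_chain_id (R : comPzRingType) (G : wdigraph R) n (v : chains R G n) :
  map_chain (wmor_id G) v = reg_proj v.
Proof.
move: v; apply: (@chains_ext R G n (chains R G n)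
  (@map_chain R G G (wmor_id G) n : {linear _ -> _})
  (@reg_proj R G n : {linear _ -> _})) => t /=.
rewrite (map_chain_epath (wmor_id G)); congr (reg_proj (epath R _)).
by apply: val_inj; rewrite /= map_id.
Qed.

Lemma map_chain_comp (R : comPzRingType) (G G' G'' : wdigraph R)
    (f : wmorphism G G') (g : wmorphism G' G'') n (v : chains R G n) :
  map_chain (wmor_comp g f) v = map_chain g (map_chain f v).
Proof.
move: v; apply: (@chains_ext R G n (chains R G'' n)
  (@map_chain R G G'' (wmor_comp g f) n : {linear _ -> _})
  (@map_chain R G' G'' g n \o @map_chain R G G' f n : {linear _ -> _})) => t /=.
(* If the image under [f] is non-regular, so is its image under [g]; the inner projection can
   therefore be dropped. *)
rewrite (map_chain_epath (wmor_comp g f)) map_chain_epath map_chain_reg_proj.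
rewrite map_chain_epath.
congr (reg_proj (epath R _)).
by apply: val_inj; rewrite /= map_comp.
Qed.

Theorem mainTheorem2 (R : comPzRingType) :
  (forall G : wdigraph R, nonvanishing G ->
     forall p : nat, path_homology_map (wmor_id G) p =1 idfun)
  /\
  (forall (G G' G'' : wdigraph R) (f : wmorphism G G') (g : wmorphism G' G''),
     nonvanishing G -> nonvanishing G' -> nonvanishing G'' ->
     forall p : nat,
       path_homology_map (wmor_comp g f) p
         =1 path_homology_map g p \o path_homology_map f p).
Proof.
split=> [G _ p | G G' G'' f g _ _ _ p].
  apply: homology_map_id => v; apply: val_inj => /=.
  by rewrite map_chain_id reg_proj_allowed //; case: v => v /= /andP[].
apply: homology_map_comp => v; apply: val_inj => /=.
exact: map_chain_comp.
Qed.
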